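(* There exist absolute constants $C_1, C_2, c > 0$ such that for every integer $d\ge 1$ there is $p_0=p_0(d)$ for which the following holds for all integers $p\ge p_0$. Put $\delta=\lceil C_1\log p\rceil$ and $m=\lceil C_2\sqrt{dp}\,\log p\rceil$ (so $\delta=\mathcal{O}(\log p)$ and $m=\mathcal{O}(\sqrt{dp}\log p)$). Let $X\in\mathbb{R}^{p\times p}$ be a fixed $d$-distributed sparse matrix. Let $A,B$ be $m\times p$ matrices such that either (a) $A$ and $B$ are drawn independently from the $\delta$-random bipartite ensemble, or (b) $A$ is drawn from the $\delta$-random bipartite ensemble and $B=A$. Let $Y=AXB^T$. Then with probability exceeding $1-p^{-c}$ (over the draw of $A,B$), the optimization program $$\text{minimize}_{\tilde X\in\mathbb{R}^{p\times p}}\ \|\tilde X\|_1\quad\text{subject to}\quad A\tilde X B^T=Y$$ has a unique optimal solution $X^\ast$, and $X^\ast=X$.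
   Context: Notation: $[p]=\{1,\dots,p\}$; for a matrix $M$, $\|M\|_1=\sum_{i,j}|M_{ij}|$ (entrywise $\ell_1$ norm). Distributed sparsity: a set $\Omega\subset[p]\times[p]$ is $d$-distributed if (1) $(i,i)\in\Omega$ for all $i\in[p]$, and (2) for every $k\in[p]$, each of the sets $\{(i,j)\in\Omega: i=k\}$ and $\{(i,j)\in\Omega: j=k\}$ has at most $d$ elements. A matrix $X\in\mathbb{R}^{p\times p}$ is $d$-distributed sparse if $\{(i,j): X_{ij}\ne 0\}\subset\Omega$ for some $d$-distributed set $\Omega$. $\delta$-random bipartite ensemble (of $m\times p$ matrices): for each left vertex $i\in[p]$, choose $\delta$ right vertices $j_1(i),\dots,j_\delta(i)\in[m]$ independently and uniformly at random with replacement, independently over different $i$; this gives a random $\delta$-left regular bipartite (multi)graph with left set $[p]$ and right set $[m]$. The matrix $A\in\mathbb{R}^{m\times p}$ has entries $A_{ji}=\#\{k\in[\delta]: j_k(i)=j\}$ (the number of edges joining left vertex $i$ to right vertex $j$). *)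

(* Defs.v *)
From HB Require Import structures.
From mathcomp Require Import all_boot all_order all_algebra.
From mathcomp Require Import boolp reals exp.

Set Implicit Arguments.
Unset Strict Implicit.
Unset Printing Implicit Defensive.

Import Order.TTheory GRing.Theory Num.Theory.
Local Open Scope ring_scope.

Definition norm1 (R : realType) (m n : nat) (M : 'M[R]_(m, n)) : R :=
  \sum_i \sum_j `|M i j|.

Definition distributed (p d : nat) (Omega : {set 'I_p * 'I_p}) : Prop :=
  (forall i, (i, i) \in Omega) /\
  (forall k, (#|[set x in Omega | x.1 == k]| <= d)%N /\
             (#|[set x in Omega | x.2 == k]| <= d)%N).

Definition distributed_sparse (R : realType) (p d : nat) (X : 'M[R]_p) : Prop :=
  exists2 Omega : {set 'I_p * 'I_p}, distributed d Omega
    & [set x | X x.1 x.2 != 0] \subset Omega.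

(* An outcome G of the random choices: [G i k] is the right vertex j_k(i)
   selected by the k-th of the delta choices of the left vertex i. *)
Definition choices (p delta m : nat) : finType :=
  {ffun 'I_p -> {ffun 'I_delta -> 'I_m}}.

(* Probability mass function of the delta-random bipartite ensemble: all the
   choices are independent, each one uniform on 'I_m. *)
Definition ensemble (R : realType) (p delta m : nat)
    (G : choices p delta m) : R :=
  \prod_(i < p) \prod_(k < delta) m%:R^-1.

(* Two independent draws from the ensemble. *)
Definition ensemble2 (R : realType) (p delta m : nat)
    (GH : choices p delta m * choices p delta m) : R :=
  ensemble R GH.1 * ensemble R GH.2.

Definition Pr (R : realType) (T : finType) (mu : T -> R) (E : T -> Prop) : R :=
  \sum_(w : T | `[< E w >]) mu w.

Definition adj_mx (R : realType) (p delta m : nat)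
    (G : choices p delta m) : 'M[R]_(m, p) :=
  \matrix_(j < m, i < p) #|[set k : 'I_delta | G i k == j]|%:R.

Definition optimal (R : realType) (p m : nat) (A B : 'M[R]_(m, p))
    (Y : 'M[R]_m) (X : 'M[R]_p) : Prop :=
  A *m X *m B^T = Y /\
  forall Z : 'M[R]_p, A *m Z *m B^T = Y -> norm1 X <= norm1 Z.

Definition recovers (R : realType) (p m : nat) (A B : 'M[R]_(m, p))
    (X : 'M[R]_p) : Prop :=
  unique (optimal A B (A *m X *m B^T)) X.

(* The absolute value only converts the ceiling from int to nat: both ceilings
   are nonnegative when C1, C2 >= 0 and p >= 1. *)
Definition left_degree (R : realType) (C1 : R) (p : nat) : nat :=
  `|Num.ceil (C1 * ln p%:R)|%N.

Definition sketch_dim (R : realType) (C2 : R) (d p : nat) : nat :=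
  `|Num.ceil (C2 * Num.sqrt (d%:R * p%:R) * ln p%:R)|%N.

(* Main.v *)
Require Import Defs.
From HB Require Import structures.
From mathcomp Require Import all_boot all_order all_algebra.
From mathcomp Require Import boolp reals exp sequences.
From mathcomp Require Import zify ring lra.

Set Implicit Arguments.
Unset Strict Implicit.
Unset Printing Implicit Defensive.

Import Order.TTheory GRing.Theory Num.Theory.
Local Open Scope ring_scope.

(* Call two edge choices (k, l) of a pair y = (a, b) a collision when the right
   vertex (G_a k, H_b l) of the tensor graph is also a neighbour of some x in
   Omega other than y. If every y has fewer than delta^2 / 2 collisions, then
   every nonzero V with A V B^T = 0 carries less l1 mass on Omega than off it:
   in a row of the system, the unique entry of Omega not shared with another
   one is cancelled by entries outside Omega that collide. Hence X is the
   unique optimum.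

   To bound the collisions of y, fix all neighbourhoods except those of a and
   b. The pairs of Omega avoiding a and b cover at most p d delta^2 points, a
   small fraction of the m^2 points of the grid, so few rows of the grid are
   heavy. Apart from exponentially unlikely events, few k put G_a k in a heavy
   row and, for every other k, few l put H_b l in the light row of G_a k. The
   pairs of Omega meeting a or b involve only O(d) neighbourhoods, which few
   choices hit. A union bound over y and k concludes. *)

(** * Counting functions with many values in a small set determined independently of them *)

Section Counting.
Local Open Scope nat_scope.

Lemma leq_card_bigcup (I T : finType) (P : pred I) (B : I -> {set T}) :
  #|\bigcup_(i | P i) B i| <= \sum_(i | P i) #|B i|.
Proof.
apply: (big_rec2 (fun (A : {set T}) n => #|A| <= n)); first by rewrite cards0.
move=> i n A _ leA; rewrite (leq_trans (leq_card_setU _ _))//.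
by rewrite leq_add2l.
Qed.

Section FreshSet.
Variables (I A : finType) (F : {ffun I -> A} -> {set A}) (Q : nat).

(** Counting form of independence: fixing [w] outside [D] fixes [f w], while the values of [w] on
    [D] remain free. *)
Definition ignores (D : {set I}) (T : Type) (f : {ffun I -> A} -> T) : Prop :=
  forall w w' : {ffun I -> A},
    (forall x, x \notin D -> w x = w' x) -> f w = f w'.

Hypothesis sizeF : forall w, Q * #|F w| <= #|A|.

(* Double counting of the pairs (w, w') that agree off D with w in the event:
   every w has |A|^|D| partners w', and every w' at most |F w'|^|D| partners
   w. *)
Lemma card_all_in (D : {set I}) : 0 < #|A| -> ignores D F ->
  #|[set w : {ffun I -> A} | [forall x in D, w x \in F w]]| * Q ^ #|D| <= #|A| ^ #|I|.
Proof.
move=> A0 FD; set E := [set w : {ffun I -> A} | _].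
pose agree (w w' : {ffun I -> A}) := [forall x, (x \notin D) ==> (w x == w' x)].
have agreeP w w' : agree w w' -> forall x, x \notin D -> w x = w' x.
  by move=> /forallP h x xD; apply/eqP; exact: (implyP (h x)).
have partners w : \sum_(w' | agree w w') 1 = #|A| ^ #|D|.
  rewrite sum1_card.
  rewrite (@eq_card _ _ (family (fun x => if x \in D then predT else pred1 (w x)))).
    rewrite card_family foldrE big_map big_enum/=.
    rewrite -prod_nat_const [RHS]big_mkcond/=; apply: eq_bigr => x _.
    by case: (x \in D); rewrite ?cardT -?cardE// card1.
  move=> w'; rewrite !inE; apply/forallP/familyP => h x; have := h x.
    by case: (x \in D) => //= /eqP ->; rewrite inE.
  by case: (x \in D) => //=; rewrite inE eq_sym.
have copartners w' : \sum_(w in E | agree w w') 1 <= #|F w'| ^ #|D|.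
  rewrite sum1_card.
  pose G (x : I) : pred A := fun y => if x \in D then y \in F w' else y == w' x.
  have /subset_leq_card/leq_trans : [pred w | (w \in E) && agree w w'] \subset family G.
    apply/subsetP => w; rewrite !inE => /andP[/forallP wE ag].
    apply/familyP => x; change (if x \in D then w x \in F w' else w x == w' x).
    have := wE x; rewrite -(FD w w' (agreeP w w' ag)).
    by case: ifPn => [//|xD _]; apply/eqP/agreeP.
  apply; rewrite card_family foldrE big_map big_enum/=.
  rewrite -prod_nat_const [leqRHS]big_mkcond/= leq_prod// => x _.
  by rewrite /G; case: (x \in D); [exact: subset_leq_card | rewrite card1].
have dc : #|E| * #|A| ^ #|D| <= \sum_w' #|F w'| ^ #|D|.
  rewrite -sum_nat_const (eq_bigr _ (fun w _ => esym (partners w))).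
  rewrite (exchange_big_dep predT)//=; apply: leq_sum => w _; exact: copartners.
have := leq_mul dc (leqnn (Q ^ #|D|)).
rewrite big_distrl/= mulnAC => h.
rewrite -(@leq_pmul2r (#|A| ^ #|D|)) ?expn_gt0 ?A0//.
apply: leq_trans h _; rewrite -card_ffun -sum_nat_const leq_sum// => w _.
by rewrite -expnMn mulnC; case: #|D| => [|k]; rewrite ?expn0 ?leq_exp2r ?sizeF.
Qed.

(** Union bound over the [t]-element subsets [T] of [D], at most [2 ^ #|D|] in number; [card_all_in]
    applies to each, since ignoring [D] entails ignoring [T]. *)
Lemma card_many_in (D : {set I}) (t : nat) : 0 < #|A| -> ignores D F ->
  #|[set w : {ffun I -> A} | t <= #|[set x in D | w x \in F w]|]| * Q ^ t
    <= 2 ^ #|D| * #|A| ^ #|I|.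
Proof.
move=> A0 FD; set E := [set w : {ffun I -> A} | _].
have sub : E \subset \bigcup_(T in [set T in powerset D | #|T| == t])
    [set w : {ffun I -> A} | [forall x in T, w x \in F w]].
  apply/subsetP => w; rewrite inE => /card_geqP[s [us <- sD]].
  apply/bigcupP; exists [set x in s].
    rewrite !inE cardsE (card_uniqP us) eqxx andbT.
    by apply/subsetP => x; rewrite inE => /sD; rewrite inE => /andP[].
  rewrite inE; apply/forallP => x; apply/implyP; rewrite inE => /sD.
  by rewrite inE => /andP[].
have := leq_trans (subset_leq_card sub) (leq_card_bigcup _ _).
move=> /leq_mul/(_ (leqnn (Q ^ t))) /leq_trans; apply.
rewrite big_distrl/= (@leq_trans (\sum_(T in [set T in powerset D | #|T| == t]) #|A| ^ #|I|))//.
  apply: leq_sum => T; rewrite !inE => /andP[TD /eqP <-].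
  apply: card_all_in => // w w' h; apply: FD => x xD; apply: h.
  by apply: contra xD => /(subsetP TD).
rewrite sum_nat_const leq_mul2r -card_powerset subset_leq_card ?orbT//.
by apply/subsetP => T; rewrite inE => /andP[].
Qed.

End FreshSet.
End Counting.

(** * Tail bound for collisions in the tensor graph *)

Section Collisions.
Local Open Scope nat_scope.

Definition nbhd (V : Type) (delta m : nat) (G : V -> 'I_delta -> 'I_m) (v : V) :
    {set 'I_m} :=
  [set G v k | k : 'I_delta].

Definition collisions (p delta m : nat) (G H : 'I_p -> 'I_delta -> 'I_m)
    (Om : {set 'I_p * 'I_p}) (y : 'I_p * 'I_p) : {set 'I_delta * 'I_delta} :=
  [set kl | [exists x in Om, [&& x != y, G y.1 kl.1 \in nbhd G x.1
                                      & H y.2 kl.2 \in nbhd H x.2]]].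

Lemma card_nbhd (V : Type) (delta m : nat) (G : V -> 'I_delta -> 'I_m) v :
  #|nbhd G v| <= delta.
Proof. by rewrite (leq_trans (leq_imset_card _ _))// cardT size_enum_ord. Qed.

(* The left vertices of the two graphs are sent to V by al and be, so that
   independent graphs (al, be the injections of a disjoint sum) and equal
   graphs (al = be = id) are handled at once. *)
Variables (V : finType) (p delta m d Q t : nat) (al be : 'I_p -> V).
Variable Om : {set 'I_p * 'I_p}.
Hypotheses (al_inj : injective al) (be_inj : injective be).
Hypothesis Om_row : forall i, #|[set x in Om | x.1 == i]| <= d.
Hypothesis Om_col : forall i, #|[set x in Om | x.2 == i]| <= d.

Notation outcome := {ffun V * 'I_delta -> 'I_m}.
Definition nb (w : outcome) := nbhd (fun v k => w (v, k)).

Section Pair.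
Variables a b : 'I_p.
Notation u := (al a).
Notation v := (be b).

(* [far w j] is the part of row j covered by the pairs of Om avoiding both u and
   v; [near1] and [near2] are the neighbourhoods through which a pair of Om
   meeting u or v can collide with (a, b) in the first, resp. second, factor. *)
Definition far (w : outcome) (j : 'I_m) : {set 'I_m} :=
  \bigcup_(x in Om | [&& al x.1 \notin [set u; v], be x.2 \notin [set u; v]
                       & j \in nb w (al x.1)]) nb w (be x.2).
Definition heavy (w : outcome) : {set 'I_m} := [set j | m < 2 * Q * #|far w j|].
Definition near1 (w : outcome) : {set 'I_m} :=
  \bigcup_(z in (v |: [set al x.1 | x in [set x in Om | x.2 == b]]) :\ u) nb w z.
Definition near2 (w : outcome) : {set 'I_m} :=
  \bigcup_(z in (u |: [set be x.2 | x in [set x in Om | x.1 == a]]) :\ v) nb w z.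

Definition bad1 (w : outcome) := near1 w :|: heavy w.
(** The empty set for a heavy row keeps [bad2] small in every outcome; the choices [k] that land in
    a heavy row are already counted by [bad1]. *)
Definition bad2 (k : 'I_delta) (w : outcome) :=
  near2 w :|: (if w (u, k) \in heavy w then set0 else far w (w (u, k))).
Definition D1 : {set V * 'I_delta} := [set x | x.1 == u].
(* The exclusion of (u, k) matters only when u = v: the row of k is fixed by the
   choice (u, k), which therefore must not be counted as fresh. *)
Definition D2 (k : 'I_delta) : {set V * 'I_delta} := [set x | (x.1 == v) && (x != (u, k))].

Lemma eq_nb (w w' : outcome) z : (forall k, w (z, k) = w' (z, k)) -> nb w z = nb w' z.
Proof. by move=> h; apply: eq_imset => k. Qed.

Lemma far_ignores (D : {set V * 'I_delta}) :
  (forall x, x \in D -> x.1 \in [set u; v]) -> ignores D far.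
Proof.
move=> DP w w' ww'; apply: funext => j.
have E z : z \notin [set u; v] -> nb w z = nb w' z.
  by move=> zuv; apply: eq_nb => k; apply: ww'; apply: contra zuv => /DP.
rewrite /far; apply: eq_big => [x|x /and4P[_ _ + _]]; last exact: E.
by case: (boolP (al x.1 \in _)) => [|/E ->]; rewrite ?andbF.
Qed.

Lemma heavy_ignores (D : {set V * 'I_delta}) :
  (forall x, x \in D -> x.1 \in [set u; v]) -> ignores D heavy.
Proof. by move=> DP w w' ww'; rewrite /heavy (far_ignores DP ww'). Qed.

Lemma bad1_ignores : ignores D1 bad1.
Proof.
move=> w w' ww'; rewrite /bad1; congr (_ :|: _).
  apply: eq_bigr => z; rewrite in_setD1 => /andP[zu _].
  by apply: eq_nb => k; apply: ww'; rewrite inE.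
by apply: heavy_ignores ww' => x; rewrite !inE => ->.
Qed.

Lemma bad2_ignores k : ignores (D2 k) (bad2 k).
Proof.
move=> w w' ww'; rewrite /bad2; congr (_ :|: _).
  apply: eq_bigr => z; rewrite in_setD1 => /andP[zv _].
  by apply: eq_nb => l; apply: ww'; rewrite inE/= (negPf zv).
have DP x : x \in D2 k -> x.1 \in [set u; v].
  by rewrite !inE => /andP[-> _]; rewrite orbT.
by rewrite (heavy_ignores DP ww') (far_ignores DP ww') ww'// inE eqxx andbF.
Qed.

Lemma card_near (f : 'I_p * 'I_p -> V) (r s : V) (w : outcome)
    (T : {set 'I_p * 'I_p}) : #|T| <= d ->
  #|\bigcup_(z in (r |: [set f x | x in T]) :\ s) nb w z| <= d.+1 * delta.
Proof.
move=> Td; apply: leq_trans (leq_card_bigcup _ _) _.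
apply: (@leq_trans (#|(r |: [set f x | x in T]) :\ s| * delta)).
  by rewrite -sum_nat_const leq_sum// => z _; exact: card_nbhd.
rewrite leq_mul2r; apply/orP; right.
rewrite (leq_trans (subset_leq_card (subD1set _ _)))//.
rewrite (leq_trans (leq_card_setU _ _))// cards1 add1n ltnS.
exact: leq_trans (leq_imset_card _ _) Td.
Qed.

(** Each pair of [Om] covers at most [delta] points in each of at most [delta] rows. *)
Lemma sum_card_far w : \sum_j #|far w j| <= #|Om| * (delta * delta).
Proof.
apply: (@leq_trans (\sum_j \sum_(x in Om | j \in nb w (al x.1)) delta)).
  apply: leq_sum => j _; apply: leq_trans (leq_card_bigcup _ _) _.
  rewrite [leqRHS]big_mkcond [leqLHS]big_mkcond; apply: leq_sum => x _.
  case: (x \in Om) => //=; case: (al x.1 \in _) => //=.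
  case: (be x.2 \in _) => //=; case: (j \in _) => //; exact: card_nbhd.
rewrite (exchange_big_dep (mem Om))/=; last by move=> j x _ /andP[].
rewrite -sum_nat_const leq_sum// => x xO.
rewrite (eq_bigl (mem (nb w (al x.1)))) => [|j]; last by rewrite xO.
by rewrite sum_nat_const leq_mul2r card_nbhd orbT.
Qed.

Hypothesis m_big : 4 * Q ^ 2 * (#|Om| * (delta * delta)) <= m ^ 2.
Hypothesis m_near : 2 * Q * (d.+1 * delta) <= m.
Hypothesis m_gt0 : 0 < m.

(** Markov's inequality: a heavy row has more than [m / (2 * Q)] covered points, out of at most
    [m ^ 2 / (4 * Q ^ 2)] in all. *)
Lemma card_heavy w : 2 * Q * #|heavy w| <= m.
Proof.
have h : #|heavy w| * m <= 2 * Q * (#|Om| * (delta * delta)).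
  apply: (@leq_trans (2 * Q * \sum_j #|far w j|)); last first.
    by rewrite leq_mul2l sum_card_far orbT.
  rewrite -sum_nat_const big_distrr/= big_mkcond leq_sum// => j _.
  by case: ifP => //; rewrite inE => /ltnW.
rewrite -(leq_pmul2r m_gt0) -mulnA.
apply: leq_trans (leq_mul (leqnn (2 * Q)) h) _.
by apply: leq_trans m_big; nia.
Qed.

Lemma card_bad1 w : Q * #|bad1 w| <= #|'I_m|.
Proof.
have h1 : #|near1 w| <= d.+1 * delta by apply: card_near.
have h2 := card_heavy w.
have h3 : #|bad1 w| <= #|near1 w| + #|heavy w| by exact: leq_card_setU.
rewrite card_ord -(@leq_pmul2l 2)//; nia.
Qed.

Lemma card_bad2 k w : Q * #|bad2 k w| <= #|'I_m|.
Proof.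
have h1 : #|near2 w| <= d.+1 * delta by apply: card_near.
have h3 : #|bad2 k w| <=
    #|near2 w| + #|if w (u, k) \in heavy w then set0 else far w (w (u, k))|.
  exact: leq_card_setU.
rewrite card_ord -(@leq_pmul2l 2)//; case: ifP h3 => [_|].
  by rewrite cards0; nia.
rewrite inE => /negbT; rewrite -leqNgt => hf /(leq_mul (leqnn (2 * Q))).
rewrite mulnDr; have := leq_mul (leqnn (2 * Q)) h1; lia.
Qed.

Definition crowded (w : outcome) : Prop :=
  t <= #|[set x in D1 | w x \in bad1 w]| \/
  exists k, t <= #|[set x in D2 k | w x \in bad2 k w]|.

Lemma card_line (z : V) : #|[set x : V * 'I_delta | x.1 == z]| <= delta.
Proof.
rewrite -[delta in leqRHS]card_ord -cardsT.
rewrite (leq_trans _ (leq_imset_card (fun k => (z, k)) _))//.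
by apply/subset_leq_card/subsetP => -[z' k]; rewrite inE => /= /eqP ->; exact: imset_f.
Qed.

(** There are [delta.+1] tail events, one for [D1] and one for each [D2 k]; [m ^ (#|V| * delta)] is
    the number of outcomes. *)
Lemma card_crowded :
  #|[set w | `[< crowded w >]]| * Q ^ t <= delta.+1 * (2 ^ delta * m ^ (#|V| * delta)).
Proof.
have tail (F : outcome -> {set 'I_m}) (D : {set V * 'I_delta}) (z : V) :
    (forall w, Q * #|F w| <= #|'I_m|) -> D \subset [set x | x.1 == z] ->
    ignores D F ->
  #|[set w : outcome | t <= #|[set x in D | w x \in F w]|]| * Q ^ t
     <= 2 ^ delta * m ^ (#|V| * delta).
  move=> sF DD ig; have := @card_many_in _ _ F Q sF D t _ ig.
  rewrite !card_ord card_prod card_ord => /(_ m_gt0)/leq_trans; apply.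
  rewrite leq_mul2r leq_exp2l// (leq_trans (subset_leq_card DD)) ?orbT//.
  exact: card_line.
have sub : [set w | `[< crowded w >]] \subset
    [set w : outcome | t <= #|[set x in D1 | w x \in bad1 w]|] :|:
    \bigcup_k [set w : outcome | t <= #|[set x in D2 k | w x \in bad2 k w]|].
  apply/subsetP => w; rewrite !inE => /asboolP[->//|[k tk]].
  by apply/orP; right; apply/bigcupP; exists k => //; rewrite inE.
apply: leq_trans (leq_mul (subset_leq_card sub) (leqnn _)) _.
apply: leq_trans (leq_mul (leq_card_setU _ _) (leqnn _)) _.
rewrite mulnDl mulSn leq_add//.
  by apply: (@tail _ _ u) => //; [exact: card_bad1 | exact: bad1_ignores].
apply: leq_trans (leq_mul (leq_card_bigcup _ _) (leqnn _)) _.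
rewrite big_distrl/=; set B := (2 ^ delta * _).
have -> : delta * B = \sum_(k < delta) B by rewrite sum_nat_const card_ord.
apply: leq_sum => k _.
apply: (@tail _ _ v); [exact: card_bad2 | | exact: bad2_ignores].
by apply/subsetP => x; rewrite !inE => /andP[].
Qed.

(** Fewer than [t] choices [k] are bad, each losing at most [delta] pairs; any other [k] loses at
    most [t] values of [l]. The total is below [2 * t * delta], hence below half of
    [delta * delta]. *)
Lemma collisions_small (w : outcome) : 0 < delta -> 4 * t <= delta ->
  ~ crowded w ->
  2 * #|collisions (fun i k => w (al i, k)) (fun i k => w (be i, k)) Om (a, b)|
    < delta * delta.
Proof.
move=> delta0 tdelta nc.
have c1 : #|[set x in D1 | w x \in bad1 w]| < t.
  by rewrite ltnNge; apply/negP => h; apply: nc; left.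
have c2 k : #|[set x in D2 k | w x \in bad2 k w]| < t.
  by rewrite ltnNge; apply/negP => h; apply: nc; right; exists k.
pose K := [set k | w (u, k) \in bad1 w].
pose L k := [set l | ((v, l) \in D2 k) && (w (v, l) \in bad2 k w)].
have Kt : #|K| < t.
  apply: leq_ltn_trans c1.
  rewrite -(card_imset _ (_ : injective (fun k : 'I_delta => (u, k)))); last by move=> ? ? [].
  apply/subset_leq_card/subsetP => _ /imsetP[k kK ->].
  by move: kK; rewrite !inE => ->; rewrite eqxx.
have Lt k : #|L k| < t.
  apply: leq_ltn_trans (c2 k).
  rewrite -(card_imset _ (_ : injective (fun k : 'I_delta => (v, k)))); last by move=> ? ? [].
  by apply/subset_leq_card/subsetP => _ /imsetP[l lL ->]; move: lL; rewrite !inE.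
set C := collisions _ _ _ _.
(* The value [l = k] is given up in advance, since [D2 k] omits it when [u = v]; as [#|L k| < t],
   each [k] still loses at most [t]. *)
have sub : C \subset setX K setT :|: \bigcup_k setX [set k] (k |: L k).
  apply/subsetP => -[k l]; rewrite inE => /existsP[[i j] /and4P[xO xab]].
  move=> /= ui vj.
  rewrite in_setU in_setX in_setT andbT.
  case: (boolP (k \in K)) => //=; rewrite inE in_setU negb_or => /andP[kF kR].
  apply/bigcupP; exists k => //; rewrite in_setX in_set1 eqxx/= in_setU1.
  case: eqVneq => //= lk; rewrite inE; apply/andP; split.
    by rewrite inE eqxx/=; apply: contra lk => /eqP[_ ->].
  rewrite in_setU (negPf kR).
  (* In turn: if [al i = u], [near2] catches the pair; if [al i = v] or [be j = v], [near1]
     contradicts [k \notin K]; if [be j = u], [near2] again; otherwise the pair avoids [u] and [v],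
     and [far] catches it. *)
  case: (eqVneq (al i) u) => [/al_inj ia|iu].
    apply/orP; left; apply/bigcupP; exists (be j) => //.
    rewrite in_setD1 in_setU1; apply/andP; split.
      by apply: contra xab => /eqP/be_inj ->; rewrite ia.
    by apply/orP; right; apply/imsetP; exists (i, j); rewrite // !inE xO ia eqxx.
  case: (eqVneq (al i) v) => [iv|iv].
    case/negP: kF; apply/bigcupP; exists (al i) => //.
    by rewrite !inE iu iv eqxx.
  case: (eqVneq (be j) v) => [/be_inj jb|jv].
    case/negP: kF; apply/bigcupP; exists (al i) => //.
    rewrite in_setD1 iu in_setU1; apply/orP; right.
    by apply/imsetP; exists (i, j); rewrite // !inE xO jb eqxx.
  case: (eqVneq (be j) u) => [ju|ju].
    by apply/orP; left; apply/bigcupP; exists (be j); rewrite // !inE jv ju eqxx.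
  apply/orP; right; apply/bigcupP; exists (i, j) => //=.
  by rewrite xO !inE !negb_or iu iv ju jv.
have cC : #|C| <= #|K| * delta + delta * t.
  apply: leq_trans (subset_leq_card sub) _.
  apply: leq_trans (leq_card_setU _ _) _; apply: leq_add.
    by rewrite cardsX cardsT card_ord.
  apply: leq_trans (leq_card_bigcup _ _) _.
  rewrite -[delta in delta * t]card_ord -sum_nat_const leq_sum// => k _.
  rewrite cardsX cards1 mul1n (leq_trans (leq_card_setU _ _))// cards1 add1n.
  exact: Lt.
nia.
Qed.

End Pair.

Lemma card_collisions :
  4 * Q ^ 2 * (#|Om| * (delta * delta)) <= m ^ 2 ->
  2 * Q * (d.+1 * delta) <= m -> 0 < m -> 0 < delta -> 4 * t <= delta ->
  #|[set w : outcome | [exists y, delta * delta <=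
       2 * #|collisions (fun i k => w (al i, k)) (fun i k => w (be i, k)) Om y|]]|
    * Q ^ t <= p ^ 2 * (delta.+1 * (2 ^ delta * m ^ (#|V| * delta))).
Proof.
move=> m_big m_near m0 delta0 tdelta; set E := [set w : outcome | _].
have sub : E \subset \bigcup_(y : 'I_p * 'I_p) [set w | `[< crowded y.1 y.2 w >]].
  apply/subsetP => w; rewrite inE => /existsP[[a b]]; rewrite leqNgt => nc.
  apply/bigcupP; exists (a, b) => //; rewrite inE; apply/asboolP.
  by apply/not_notP => h; case/negP: nc; exact: collisions_small.
apply: leq_trans (leq_mul (subset_leq_card sub) (leqnn _)) _.
apply: leq_trans (leq_mul (leq_card_bigcup _ _) (leqnn _)) _.
rewrite big_distrl/=; set B := (delta.+1 * _).
have -> : p ^ 2 * B = \sum_(y : 'I_p * 'I_p) B.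
  by rewrite sum_nat_const card_prod card_ord mulnn.
by apply: leq_sum => -[a b] _; exact: card_crowded.
Qed.

End Collisions.

(** * Null space property and exact recovery *)

Section Recovery.
Variable R : realType.

Section NullSpace.
Variables (I J : finType) (T : J -> I -> R) (Om : {set I}) (s : R).

Definition shared (r : J) (y : I) := [exists x in Om, (x != y) && (T r x != 0)].

Hypothesis T_ge0 : forall r x, 0 <= T r x.
Hypothesis T_colsum : forall x, \sum_r T r x = s.
Hypothesis T_shared : forall y, 2 * (\sum_(r | shared r y) T r y) < s.

(** If an unshared [x0] of [Om] has [T r x0 != 0], it is the only entry of [Om] in row [r]: the
    equation bounds it by the entries off [Om], all of which share the row with [x0]. Otherwise the
    left side vanishes. *)
Lemma row_unshared_le (v : I -> R) (r : J) : \sum_x T r x * v x = 0 ->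
  \sum_(x in Om | ~~ shared r x) T r x * `|v x|
    <= \sum_(y | (y \notin Om) && shared r y) T r y * `|v y|.
Proof.
move=> Tv0.
have [/existsP[x0 /and3P[x0O nsh Tx0]]|/existsPn none] :=
    boolP [exists x, [&& x \in Om, ~~ shared r x & T r x != 0]]; last first.
  rewrite big1 ?sumr_ge0// => [x _|x /andP[xO nsh]]; first exact: mulr_ge0.
  by have := none x; rewrite xO nsh/= negbK => /eqP ->; rewrite mul0r.
have T0 x : x \in Om -> x != x0 -> T r x = 0.
  move=> xO xx0; apply/eqP; apply: contraNT nsh => Tx.
  by apply/existsP; exists x; rewrite xO xx0.
have sumOm (f : I -> R) (P : pred I) : P x0 ->
    \sum_(x in Om | P x) T r x * f x = T r x0 * f x0.
  move=> Px0; rewrite (bigD1 x0) ?x0O//= big1 ?addr0// => x /andP[/andP[xO _] xx0].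
  by rewrite T0 ?mul0r.
rewrite (sumOm (fun x => `|v x|))//.
have -> : \sum_(y | (y \notin Om) && shared r y) T r y * `|v y| =
          \sum_(y | y \notin Om) T r y * `|v y|.
  apply: eq_bigl => y; case: (boolP (y \in Om)) => //= yO.
  apply/existsP; exists x0; rewrite x0O Tx0 andbT/=.
  by apply: contraNneq yO => <-.
have : T r x0 * v x0 = - \sum_(y | y \notin Om) T r y * v y.
  rewrite -(sumOm v predT)//; apply/eqP; rewrite -addr_eq0; apply/eqP.
  rewrite -[RHS]Tv0 [RHS](bigID (mem Om))/=; congr (_ + _).
  by apply: eq_bigl => x; rewrite andbT.
move=> /(congr1 Num.norm); rewrite normrN normrM ger0_norm// => ->.
rewrite (le_trans (ler_norm_sum _ _ _))// ler_sum// => y _.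
by rewrite normrM ger0_norm.
Qed.

(** Summed over [r], the row inequalities give weight [s - e x > s / 2] on [Om] against
    [e x < s / 2] off it, where [e x] is the mass of column [x] in shared rows. The nonzero [v x0]
    makes the result strict. *)
Lemma null_space_property (v : I -> R) (x0 : I) :
  (forall r, \sum_x T r x * v x = 0) -> v x0 != 0 ->
  \sum_(x in Om) `|v x| < \sum_(x | x \notin Om) `|v x|.
Proof.
move=> Tv0 vx0; pose e y := \sum_(r | shared r y) T r y.
have e_ge0 y : 0 <= e y by exact: sumr_ge0.
have s_gt0 : 0 < s.
  by apply: le_lt_trans (T_shared x0); rewrite mulr_ge0// -/(e x0).
have main : \sum_(x in Om) (s - e x) * `|v x| <= \sum_(x | x \notin Om) e x * `|v x|.
  have E1 : \sum_(x in Om) (s - e x) * `|v x| =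
      \sum_r \sum_(x in Om | ~~ shared r x) T r x * `|v x|.
    rewrite (exchange_big_dep (mem Om))/=; last by move=> r x _ /andP[].
    apply: eq_bigr => x xO; rewrite -big_distrl/=; congr (_ * _).
    rewrite -(T_colsum x) (bigID (fun r => shared r x))/= -/(e x) addrC addrK.
    by apply: eq_bigl => r; rewrite xO.
  have E2 : \sum_(x | x \notin Om) e x * `|v x| =
      \sum_r \sum_(y | (y \notin Om) && shared r y) T r y * `|v y|.
    rewrite (exchange_big_dep (fun y => y \notin Om))/=; last by move=> r x _ /andP[].
    apply: eq_bigr => x xO; rewrite -big_distrl/=; congr (_ * _).
    by apply: eq_bigl => r; rewrite xO.
  by rewrite E1 E2; apply: ler_sum => r _; exact: row_unshared_le.
have pos : 0 < \sum_x (s / 2 - e x) * `|v x|.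
  have te x : 0 < s / 2 - e x by have := T_shared x; rewrite -/(e x); lra.
  rewrite (bigD1 x0)//= ltr_pwDl//; first by rewrite mulr_gt0// normr_gt0.
  by rewrite sumr_ge0// => x _; rewrite mulr_ge0// ltW.
pose h x := (s / 2 - e x) * `|v x|.
have sumIn : \sum_(x in Om) (s - e x) * `|v x| =
    \sum_(x in Om) h x + s / 2 * \sum_(x in Om) `|v x|.
  by rewrite big_distrr/= -big_split; apply: eq_bigr => x _; rewrite /h/=; lra.
have sumOut : \sum_(x | x \notin Om) e x * `|v x| =
    s / 2 * \sum_(x | x \notin Om) `|v x| - \sum_(x | x \notin Om) h x.
  by rewrite big_distrr/= -sumrB; apply: eq_bigr => x _; rewrite /h/=; lra.
rewrite (bigID (mem Om))/= -/(h _) in pos.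
rewrite -(ltr_pM2l (_ : 0 < s / 2)); last by rewrite divr_gt0.
by move: main pos; rewrite sumIn sumOut /h; lra.
Qed.

End NullSpace.

Lemma norm1E (m n : nat) (M : 'M[R]_(m, n)) : norm1 M = \sum_x `|M x.1 x.2|.
Proof. by rewrite /norm1 pair_bigA. Qed.

Lemma tensor_apply (p m : nat) (A B : 'M[R]_(m, p)) (Z : 'M[R]_p) j j' :
  (A *m Z *m B^T) j j' = \sum_x (A j x.1 * B j' x.2) * Z x.1 x.2.
Proof.
rewrite mxE -(pair_bigA _ (fun i i' => A j i * B j' i' * Z i i'))/= exchange_big/=.
apply: eq_bigr => i' _; rewrite !mxE big_distrl/=; apply: eq_bigr => i _.
by rewrite mulrAC.
Qed.

Section Graphs.
Variables (p delta m : nat) (G H : choices p delta m).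

Lemma adj_mx_sum j i : adj_mx R G j i = \sum_k (G i k == j)%:R.
Proof. by rewrite mxE -sum1dep_card natr_sum big_mkcond; apply: eq_bigr => k _; case: eqP. Qed.

Lemma adj_mx_neq0 j i : (adj_mx R G j i != 0) = (j \in nbhd (fun i k => G i k) i).
Proof.
rewrite mxE pnatr_eq0 cards_eq0; apply/set0Pn/imsetP => [[k]|[k _ ->]].
  by rewrite inE => /eqP <-; exists k.
by exists k; rewrite inE.
Qed.

End Graphs.

(** Adjacency entries count edges with multiplicity, so column masses of the tensor matrix are
    numbers of pairs of choices; this links [T_shared] to [collisions]. *)
Lemma sum_tensor (p delta m : nat) (G H : choices p delta m)
    (P : pred ('I_m * 'I_m)) (y : 'I_p * 'I_p) :
  \sum_(r | P r) adj_mx R G r.1 y.1 * adj_mx R H r.2 y.2 =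
  #|[set kl | P (G y.1 kl.1, H y.2 kl.2)]|%:R.
Proof.
rewrite -sum1dep_card natr_sum [RHS]big_mkcond/=.
rewrite (eq_bigr (fun r => \sum_(kl : 'I_delta * 'I_delta)
    (G y.1 kl.1 == r.1)%:R * (H y.2 kl.2 == r.2)%:R)); last first.
  by move=> r _; rewrite !adj_mx_sum big_distrlr/= pair_bigA.
rewrite exchange_big/=; apply: eq_bigr => -[k l] _ /=.
rewrite big_mkcond (bigD1 (G y.1 k, H y.2 l))//= !eqxx mulr1 big1 ?addr0//.
move=> [j j']; case: ifP => // _ /=; rewrite xpair_eqE negb_and.
by rewrite ![_ == G _ _]eq_sym ![_ == H _ _]eq_sym => /orP[] /negPf ->; rewrite ?mul0r ?mulr0.
Qed.

(** For another feasible [Z], the difference [v] lies in the kernel and equals [Z] off [Om]. There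
    its mass exceeds its mass on [Om], which bounds what [X] can lose on [Om] by the triangle
    inequality. *)
Lemma recovers_of_few_collisions (p delta m : nat) (G H : choices p delta m)
    (Om : {set 'I_p * 'I_p}) (X : 'M[R]_p) :
  [set x | X x.1 x.2 != 0] \subset Om ->
  (forall y, 2 * #|collisions (fun i k => G i k) (fun i k => H i k) Om y| < delta * delta)%N ->
  recovers (adj_mx R G) (adj_mx R H) X.
Proof.
move=> XO few; set A := adj_mx R G; set B := adj_mx R H.
pose T (r : 'I_m * 'I_m) (x : 'I_p * 'I_p) := A r.1 x.1 * B r.2 x.2.
have better Z : A *m Z *m B^T = A *m X *m B^T -> Z != X -> norm1 X < norm1 Z.
  move=> AZ ZX; pose v x := Z x.1 x.2 - X x.1 x.2.
  have [x0 vx0] : exists x0, v x0 != 0.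
    apply/existsP; apply: contraNT ZX => /existsPn h; apply/eqP/matrixP => i j.
    by have := h (i, j); rewrite negbK subr_eq0 => /eqP.
  have Tv0 r : \sum_x T r x * v x = 0.
    under eq_bigr do rewrite mulrBr; rewrite sumrB -!tensor_apply AZ subrr//.
  have T_ge0 r x : 0 <= T r x by rewrite mulr_ge0// mxE.
  have Tsum x : \sum_r T r x = (delta * delta)%:R.
    rewrite (sum_tensor G H predT); congr _%:R.
    by rewrite (eq_card (_ : _ =i predT)) ?card_prod ?card_ord// => kl; rewrite inE.
  have Tsh y : 2 * (\sum_(r | shared T Om r y) T r y) < (delta * delta)%:R.
    rewrite sum_tensor -natrM ltr_nat; apply: leq_ltn_trans (few y).
    rewrite leq_mul2l; apply/subset_leq_card/subsetP => kl; rewrite !inE.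
    move=> /existsP[x /and3P[xO xy]]; rewrite /T/= mulf_eq0 negb_or !adj_mx_neq0 => h.
    by apply/existsP; exists x; rewrite xO xy.
  have nsp := null_space_property T_ge0 Tsum Tsh Tv0 vx0.
  rewrite !norm1E [ltLHS](bigID (mem Om))/= [ltRHS](bigID (mem Om))/=.
  have X0 x : x \notin Om -> X x.1 x.2 = 0.
    move=> xO; apply/eqP; apply: contraNT xO => Xx.
    by apply: (subsetP XO); rewrite inE.
  have -> : \sum_(x | x \notin Om) `|X x.1 x.2| = 0.
    by rewrite big1// => x /X0 ->; rewrite normr0.
  have vE : \sum_(x | x \notin Om) `|v x| = \sum_(x | x \notin Om) `|Z x.1 x.2|.
    by apply: eq_bigr => x /X0 X0x; rewrite /v X0x subr0.
  have : \sum_(x in Om) `|X x.1 x.2| <=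
      \sum_(x in Om) `|Z x.1 x.2| + \sum_(x in Om) `|v x|.
    rewrite -big_split ler_sum// => x _ /=.
    by rewrite -[X in `|X| <= _](subKr (Z x.1 x.2)) (le_trans (ler_normB _ _)).
  by move: nsp; rewrite vE; lra.
split; first split=> // Z AZ.
  by have [->//|/better] := eqVneq Z X => /(_ AZ)/ltW.
move=> Z [AZ Zopt]; apply/esym/eqP; apply: contraT => ZX.
by have := better Z AZ ZX; rewrite ltNge Zopt.
Qed.

End Recovery.

(** * From counts of outcomes to probabilities *)

Section Probability.
Variable R : realType.

(** Both laws are uniform ([ensembleE], [ensemble2E]), so it suffices to count the outcomes that
    fail. *)
Lemma Pr_uniform_ge (T : finType) (mu : T -> R) (E : T -> Prop) (N : nat) :
  (forall w, mu w = #|T|%:R^-1) -> (0 < N)%N -> (0 < #|T|)%N ->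
  (#|[set w | ~~ `[< E w >]]| * N <= #|T|)%N -> 1 - N%:R^-1 <= Pr mu E.
Proof.
move=> muE N0 T0 bad; have Tgt0 : 0 < #|T|%:R :> R by rewrite ltr0n.
have muP (P : pred T) : \sum_(w | P w) mu w = #|P|%:R / #|T|%:R.
  by rewrite (eq_bigr _ (fun w _ => muE w)) sumr_const -[LHS]mulr_natl.
have total : \sum_w mu w = 1 by rewrite muP divff ?gt_eqF.
rewrite lerBlDr -[X in X <= _]total (bigID (fun w => `[< E w >]))/= lerD2l muP ler_pdivrMr//.
by rewrite mulrC ler_pdivlMr ?ltr0n// -natrM ler_nat -cardsE.
Qed.

Lemma card_choices (p delta m : nat) : #|choices p delta m| = (m ^ (p * delta))%N.
Proof. by rewrite !card_ffun !card_ord mulnC expnM. Qed.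

Lemma ensembleE (p delta m : nat) (G : choices p delta m) :
  ensemble R G = #|choices p delta m|%:R^-1.
Proof.
by rewrite /ensemble !prodr_const !card_ord -exprM card_choices natrX exprVn mulnC.
Qed.

Lemma ensemble2E (p delta m : nat) (GH : choices p delta m * choices p delta m) :
  ensemble2 R GH = #|{: choices p delta m * choices p delta m}|%:R^-1.
Proof. by rewrite /ensemble2 !ensembleE card_prod natrM invfM. Qed.

Section SampleSize.
Variables (d p delta m Q : nat) (Om : {set 'I_p * 'I_p}).
Hypotheses (Q_big : (2 ^ 32 <= Q)%N) (delta_ge4 : (4 <= delta)%N).
Hypotheses (p_gt0 : (0 < p)%N) (p_le : (p ^ 2 <= 2 ^ delta)%N) (m_gt0 : (0 < m)%N).
Hypothesis m_big : (4 * Q ^ 2 * (p * d * (delta * delta)) <= m ^ 2)%N.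
Hypothesis m_near : (2 * Q * (d.+1 * delta) <= m)%N.
Hypothesis Om_row : forall i, (#|[set x in Om | x.1 == i]| <= d)%N.
Hypothesis Om_col : forall i, (#|[set x in Om | x.2 == i]| <= d)%N.

Lemma card_Om : (#|Om| <= p * d)%N.
Proof.
rewrite -sum1_card (partition_big fst predT)//= -[p in (p * d)%N]card_ord -sum_nat_const.
by apply: leq_sum => i _; rewrite sum1dep_card.
Qed.

Lemma card_collisions_le (V : finType) (al be : 'I_p -> V) :
  injective al -> injective be ->
  (#|[set w : {ffun V * 'I_delta -> 'I_m} | [exists y, delta * delta <=
       2 * #|collisions (fun i k => w (al i, k)) (fun i k => w (be i, k)) Om y|]]|
    * p ^ 2 <= m ^ (#|V| * delta))%N.
Proof.
move=> al_inj be_inj; set bad := #|_|; set M := (m ^ _)%N.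
have h : (bad * Q ^ (delta %/ 4) <= p ^ 2 * (delta.+1 * (2 ^ delta * M)))%N.
  apply: (@card_collisions V p delta m d) => //; last 2 first.
  - exact: leq_trans delta_ge4.
  - by rewrite mulnC leq_trunc_div.
  apply: leq_trans m_big; rewrite leq_mul2l leq_mul2r card_Om !orbT//.
(* As delta %/ 4 >= delta / 8, this gains 2 ^ (4 delta), which pays for the
   factors delta.+1, 2 ^ delta and p ^ 4 <= 2 ^ (2 delta). *)
have Qt : (2 ^ (4 * delta) <= Q ^ (delta %/ 4))%N.
  apply: (@leq_trans ((2 ^ 32) ^ (delta %/ 4))).
    rewrite -expnM leq_exp2l//; have := divn_eq delta 4; have := ltn_pmod delta (isT : 0 < 4)%N.
    have : (0 < delta %/ 4)%N by rewrite divn_gt0.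
    lia.
  by rewrite leq_exp2r ?divn_gt0.
have d1 : (delta.+1 <= 2 ^ delta)%N by apply: ltn_expl.
have b1 : (bad * 2 ^ (4 * delta) <= p ^ 2 * (2 ^ delta * (2 ^ delta * M)))%N.
  apply: leq_trans (leq_mul (leqnn _) Qt) (leq_trans h _).
  by rewrite leq_mul2l leq_mul2r d1 !orbT.
have E4 : (2 ^ (4 * delta) = 2 ^ delta * 2 ^ delta * (2 ^ delta * 2 ^ delta))%N.
  by rewrite -!expnD; congr expn; lia.
have P0 : (0 < 2 ^ delta)%N by rewrite expn_gt0.
have p20 : (0 < p ^ 2)%N by rewrite expn_gt0 p_gt0.
move: b1 p_le P0 p20; rewrite E4.
move: (2 ^ delta)%N (p ^ 2)%N => D P b1 PD D0 P0.
(* After multiplication by [P * D ^ 2], the chain is [bad * P ^ 2 * D ^ 2 <= bad * D ^ 4 <= P * D ^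
   2 * M], by [P <= D] and [b1]. *)
rewrite -(@leq_pmul2r (P * (D * D)))//; last by rewrite !muln_gt0 D0 P0.
apply: leq_trans (_ : bad * (D * D * (D * D)) <= _)%N.
  by rewrite -mulnA leq_mul2l mulnA leq_mul2r leq_mul ?orbT.
by apply: leq_trans b1 _; rewrite !mulnA (mulnC M) -!mulnA leq_mul2l (mulnC M) !mulnA leqnn orbT.
Qed.

Variable X : 'M[R]_p.
Hypothesis X_supp : [set x | X x.1 x.2 != 0] \subset Om.

Lemma not_recovers_collisions (G H : choices p delta m) :
  ~~ `[< recovers (adj_mx R G) (adj_mx R H) X >] ->
  [exists y, (delta * delta <=
     2 * #|collisions (fun i k => G i k) (fun i k => H i k) Om y|)%N].
Proof.
apply: contraNT => /existsPn few; apply/asboolP.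
by apply: recovers_of_few_collisions X_supp _ => y; rewrite ltnNge.
Qed.

Lemma Pr_recovers_same :
  1 - (p ^ 2)%:R^-1 <=
    Pr (@ensemble R p delta m) (fun G => recovers (adj_mx R G) (adj_mx R G) X).
Proof.
apply: Pr_uniform_ge; [exact: ensembleE | by rewrite expn_gt0 p_gt0 | |].
  by rewrite card_choices expn_gt0 m_gt0.
rewrite card_choices.
have := card_collisions_le (@inj_id 'I_p) (@inj_id 'I_p); rewrite card_ord.
apply: leq_trans; rewrite leq_mul2r; apply/orP; right.
pose enc (G : choices p delta m) := [ffun x : 'I_p * 'I_delta => G x.1 x.2].
have enc_inj : injective enc.
  move=> G G' /ffunP GG'; apply/ffunP => i; apply/ffunP => k.
  by have := GG' (i, k); rewrite !ffunE.
rewrite -(card_imset _ enc_inj); apply/subset_leq_card/subsetP => _ /imsetP[G + ->].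
rewrite !inE => /not_recovers_collisions/existsP[y hy]; apply/existsP; exists y.
have -> // : (fun i k => enc G (i, k)) = (fun i k => G i k).
by apply: funext => i; apply: funext => k; rewrite ffunE.
Qed.

Lemma Pr_recovers_indep :
  1 - (p ^ 2)%:R^-1 <=
    Pr (@ensemble2 R p delta m)
       (fun GH => recovers (adj_mx R GH.1) (adj_mx R GH.2) X).
Proof.
apply: Pr_uniform_ge; [exact: ensemble2E | by rewrite expn_gt0 p_gt0 | |].
  by rewrite card_prod card_choices muln_gt0 expn_gt0 m_gt0.
have inl_inj : injective (@inl 'I_p 'I_p) by move=> ? ? [].
have inr_inj : injective (@inr 'I_p 'I_p) by move=> ? ? [].
rewrite card_prod card_choices.
have := card_collisions_le inl_inj inr_inj.
rewrite card_sum card_ord mulnDl expnD.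
apply: leq_trans; rewrite leq_mul2r; apply/orP; right.
(* The two graphs become one outcome on the disjoint sum of two copies of the left vertices. *)
pose enc (GH : choices p delta m * choices p delta m) :
    {ffun ('I_p + 'I_p) * 'I_delta -> 'I_m} :=
  [ffun x : ('I_p + 'I_p) * 'I_delta =>
    match x.1 with inl i => GH.1 i x.2 | inr i => GH.2 i x.2 end].
have enc_inj : injective enc.
  move=> [G H] [G' H'] /ffunP E; congr (_, _); apply/ffunP => i; apply/ffunP => k.
    by have := E (inl i, k); rewrite !ffunE.
  by have := E (inr i, k); rewrite !ffunE.
rewrite -(card_imset _ enc_inj); apply/subset_leq_card/subsetP => _ /imsetP[GH + ->].
rewrite !inE => /not_recovers_collisions/existsP[y hy]; apply/existsP; exists y.
have -> : (fun i k => enc GH (inl i, k)) = (fun i k => GH.1 i k).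
  by apply: funext => i; apply: funext => k; rewrite ffunE.
have -> // : (fun i k => enc GH (inr i, k)) = (fun i k => GH.2 i k).
by apply: funext => i; apply: funext => k; rewrite ffunE.
Qed.

End SampleSize.

(** * Numerical bounds on logarithms, [delta] and [m] *)

Lemma absz_ceil_ge (x : R) : 0 <= x -> x <= (`|Num.ceil x|%N)%:R < x + 1.
Proof.
move=> x0; have := ceil_itv x; rewrite natr_absz ger0_norm ?ceil_ge0; last first.
  by rewrite (lt_le_trans _ x0)// ltrN10.
by rewrite intrB ltrBlDr andbC.
Qed.

Lemma expR_half_le2 : expR (1 / 2) <= 2 :> R.
Proof.
have := expR_ge1Dx (- (1 / 2) : R); rewrite expRN => h.
have e0 := expR_gt0 (1 / 2 : R).
rewrite -ler_pV2 ?inE ?unitfE ?gt_eqF//; lra.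
Qed.

Lemma ln_natr_ge1 (p : nat) : (4 <= p)%N -> 1 <= ln p%:R :> R.
Proof.
move=> p4; have p0 : 0 < p%:R :> R by rewrite ltr0n (leq_trans _ p4).
rewrite -[X in X <= _](expRK 1) ler_ln ?posrE ?expR_gt0//.
have -> : expR 1 = expR (1 / 2) * expR (1 / 2) :> R.
  by rewrite -expRD; congr expR; field.
have e0 := expR_ge0 (1 / 2 : R).
apply: le_trans (ler_pM e0 e0 expR_half_le2 expR_half_le2) _.
have : 4 <= p%:R :> R by rewrite (ler_nat _ 4).
lra.
Qed.

(** With [L = ln p >= 1], the ceiling gives [4 * L <= delta <= 4 * L + 1 <= 5 * L], and [p ^ 2 = exp
    (2 * L) <= exp (delta / 2) <= 2 ^ delta] by [expR_half_le2]. *)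
Lemma left_degree_bounds (p : nat) : (4 <= p)%N ->
  [/\ (4 <= left_degree (4 : R) p)%N, (p ^ 2 <= 2 ^ left_degree (4 : R) p)%N
    & (left_degree (4 : R) p)%:R <= 5 * ln p%:R :> R].
Proof.
move=> p4; have L1 := ln_natr_ge1 p4; set L := ln p%:R in L1 *.
have L0 : 0 <= 4 * L by lra.
have /andP[] := absz_ceil_ge L0.
rewrite -/(left_degree (4 : R) p); set delta := left_degree _ _ => d1 d2.
have p0 : 0 < p%:R :> R by rewrite ltr0n (leq_trans _ p4).
split; last lra.
  by rewrite -(ler_nat R); apply: le_trans d1; lra.
rewrite -(ler_nat R) !natrX.
have -> : p%:R ^+ 2 = expR (2 * L).
  by rewrite /L mulr_natl -lnXn// lnK// posrE exprn_gt0.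
have : expR (2 * L) <= expR (delta%:R * (1 / 2)) by rewrite ler_expR; lra.
move=> /le_trans; apply; rewrite expRM_natl lerXn2r ?nnegrE ?expR_ge0//.
exact: expR_half_le2.
Qed.

(** The factor 10 is [2 * 5]: as [delta <= 5 * ln p], [m >= 2 * Q * sqrt (d * p) * delta], and
    squaring gives the second bound. The third follows from it by [d.+1 <= 2 * d] and
    [4 * d <= p]. *)
Lemma sketch_dim_bounds (d p Q delta : nat) : (1 <= d)%N -> (4 * d <= p)%N ->
  (0 < Q)%N -> (0 < delta)%N -> delta%:R <= 5 * ln p%:R :> R ->
  let m := sketch_dim (10 * Q%:R : R) d p in
  [/\ (0 < m)%N, (4 * Q ^ 2 * (p * d * (delta * delta)) <= m ^ 2)%N
    & (2 * Q * (d.+1 * delta) <= m)%N].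
Proof.
move=> d1 dp Q0 delta0 dL m.
set S := Num.sqrt (d%:R * p%:R) : R.
have S0 : 0 <= S by exact: sqrtr_ge0.
have S2 : S ^+ 2 = d%:R * p%:R by rewrite sqr_sqrtr// mulr_ge0.
have mS : 2 * Q%:R * S * delta%:R <= m%:R.
  have L0 : 0 <= 10 * Q%:R * S * ln p%:R.
    by rewrite !mulr_ge0// (le_trans _ (ln_natr_ge1 _))//; lia.
  have /andP[+ _] := absz_ceil_ge L0.
  rewrite -/(sketch_dim (10 * Q%:R) d p) -/m; apply: le_trans.
  have -> : 10 * Q%:R * S * ln p%:R = 2 * Q%:R * S * (5 * ln p%:R) by ring.
  by rewrite ler_wpM2l// !mulr_ge0.
have m2 : (4 * Q ^ 2 * (p * d * (delta * delta)) <= m ^ 2)%N.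
  rewrite -(ler_nat R) natrX.
  have n0 : 0 <= 2 * Q%:R * S * delta%:R by rewrite !mulr_ge0.
  apply: le_trans (lerXn2r 2 n0 (ler0n _ _) mS).
  by rewrite !exprMn S2 !natrM le_eqVlt; apply/orP; left; apply/eqP; ring.
have near : (2 * Q * (d.+1 * delta) <= m)%N.
  rewrite -leq_sqr; apply: leq_trans m2.
  apply: (@leq_trans ((2 * Q * (2 * d * delta)) ^ 2)).
    by rewrite leq_sqr !leq_mul//; lia.
  have -> : ((2 * Q * (2 * d * delta)) ^ 2 = 4 * Q ^ 2 * (4 * d * d * (delta * delta)))%N by ring.
  by rewrite !leq_mul.
split=> //; apply: leq_trans near; rewrite !muln_gt0 Q0 delta0//.
Qed.

End Probability.

Theorem theorem1 (R : realType) :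
  exists C1 C2 c : R, [/\ 0 < C1, 0 < C2, 0 < c &
    forall d : nat, (1 <= d)%N ->
    exists p0 : nat, forall p : nat, (p0 <= p)%N ->
    let delta := left_degree C1 p in
    let m := sketch_dim C2 d p in
    forall X : 'M[R]_p, distributed_sparse d X ->
      1 - p%:R `^ (- c) <
        Pr (@ensemble2 R p delta m)
           (fun GH => recovers (adj_mx R GH.1) (adj_mx R GH.2) X)
      /\
      1 - p%:R `^ (- c) <
        Pr (@ensemble R p delta m)
           (fun G => recovers (adj_mx R G) (adj_mx R G) X)].
Proof.
(* Q is kept abstract: 2 ^ 32 must not be computed in unary. *)
have above N : exists Q, (N <= Q)%N by exists N.
have [Q Q_big] := above (2 ^ 32)%N.
have Q0 : (0 < Q)%N by apply: leq_trans Q_big; rewrite expn_gt0.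
exists 4, (10 * Q%:R), 1; split; rewrite ?mulr_gt0 ?ltr0n// => d d1.
exists (4 * d)%N => p dp delta m X [Om [_ Om_deg] XO].
have p4 : (4 <= p)%N by lia.
have [delta4 p_le deltaL] := left_degree_bounds R p4.
have [m0 m_big m_near] :=
  sketch_dim_bounds d1 dp Q0 (leq_trans (isT : (0 < 4)%N) delta4) deltaL.
have p0 : (0 < p)%N by lia.
(* The failure bound [p ^ -2] is strictly below [p ^ -1], so [c = 1] gives the strict inequality. *)
have lt_bound : 1 - p%:R `^ (- 1) < 1 - (p ^ 2)%:R^-1 :> R.
  rewrite powR_inv1 ?ler0n// ltrD2l ltrN2 ltf_pV2 ?posrE ?ltr0n ?expn_gt0 ?p0//.
  by rewrite ltr_nat -[X in (X < _)%N]expn1 ltn_exp2l; lia.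
have Om_row i := (Om_deg i).1; have Om_col i := (Om_deg i).2.
split; apply: lt_le_trans lt_bound _.
- exact: (Pr_recovers_indep Q_big delta4 p0 p_le m0 m_big m_near Om_row Om_col XO).
- exact: (Pr_recovers_same Q_big delta4 p0 p_le m0 m_big m_near Om_row Om_col XO).
Qed.
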